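(* Let $\alpha\in\mathbb{C}$. The Chazy X.a equation $$u'''=6u^2u'+\frac{3}{11}(9+7\sqrt3)\left(u'+u^2\right)^2-\frac{1}{22}(4-3\sqrt3)\alpha u'+\frac{1}{44}(3-5\sqrt3)\alpha u^2-\frac{1}{352}(9+7\sqrt3)\alpha^2$$ can be transformed into the Chazy X.b equation with the same parameter $\alpha$, $$p'''=6p^2p'+\frac{3}{11}(9-7\sqrt3)\left(p'+p^2\right)^2-\frac{1}{22}(4+3\sqrt3)\alpha p'+\frac{1}{44}(3+5\sqrt3)\alpha p^2-\frac{1}{352}(9-7\sqrt3)\alpha^2,$$ by the birational transformation $g_0:(u;\alpha)\mapsto(p;\alpha)$, $$\begin{aligned} p=\frac{3+\sqrt3}{1056\{(3+\sqrt3)uu'-u''\}}\Bigl\{&288(6+\sqrt3)u^2u'-176(3+\sqrt3)uu''+96(9+7\sqrt3)u^4+64(-3+5\sqrt3)(u')^2\\ &-8(-3+5\sqrt3)\alpha u^2+16(-4+3\sqrt3)\alpha u'-(9+7\sqrt3)\alpha^2\Bigr\}. \end{aligned}$$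
   Context: Primes denote derivatives with respect to the complex variable $t$. The claim means: if $u$ solves the X.a equation then, wherever the denominator is nonzero, $p$ solves the X.b equation; and the induced map $(u,u',u'')\mapsto(p,p',p'')$, with $p',p''$ expressed through $u,u',u''$ by means of the equation for $u$, is birational. *)

(* Defs.v *)
From HB Require Import structures.
From mathcomp Require Import all_boot all_order all_algebra.
From mathcomp Require Import boolp classical_sets reals topology normedtype derive.
From mathcomp Require Import complex.
(* The notations of mpoly clash with those of analysis. *)
From mathcomp Require Import -(notations) mpoly.

Set Implicit Arguments.
Unset Strict Implicit.
Unset Printing Implicit Defensive.

Import Order.TTheory GRing.Theory Num.Theory.
Import numFieldNormedType.Exports.

Local Open Scope ring_scope.
Local Open Scope classical_set_scope.

(* The complex numbers.  The type ascription lets the topology and the norm of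
   a numFieldType apply, so that f^`() is the complex derivative. *)
Definition Cplx (R : realType) : numClosedFieldType := R[i].

(* The formulas below are written over an arbitrary field F, with s in the role
   of the square root of 3 and a in the role of alpha: they are used both for
   complex numbers and for rational functions. *)

Definition chazyXa_rhs (F : fieldType) (s a u u1 : F) : F :=
  6 * u ^+ 2 * u1
  + 3 / 11 * (9 + 7 * s) * (u1 + u ^+ 2) ^+ 2
  - 1 / 22 * (4 - 3 * s) * a * u1
  + 1 / 44 * (3 - 5 * s) * a * u ^+ 2
  - 1 / 352 * (9 + 7 * s) * a ^+ 2.

Definition chazyXb_rhs (F : fieldType) (s a p p1 : F) : F :=
  6 * p ^+ 2 * p1
  + 3 / 11 * (9 - 7 * s) * (p1 + p ^+ 2) ^+ 2
  - 1 / 22 * (4 + 3 * s) * a * p1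
  + 1 / 44 * (3 + 5 * s) * a * p ^+ 2
  - 1 / 352 * (9 - 7 * s) * a ^+ 2.

Definition g0_den (F : fieldType) (s u u1 u2 : F) : F :=
  (3 + s) * u * u1 - u2.

Definition g0 (F : fieldType) (s a u u1 u2 : F) : F :=
  (3 + s) / (1056 * g0_den s u u1 u2)
  * (288 * (6 + s) * u ^+ 2 * u1
     - 176 * (3 + s) * u * u2
     + 96 * (9 + 7 * s) * u ^+ 4
     + 64 * (- 3 + 5 * s) * u1 ^+ 2
     - 8 * (- 3 + 5 * s) * a * u ^+ 2
     + 16 * (- 4 + 3 * s) * a * u1
     - (9 + 7 * s) * a ^+ 2).

(* The equation u''' = rhs u u' on an open set D of complex times.  Outside D,
   u is an arbitrary total function. *)
Definition solves (K : numClosedFieldType) (rhs : K -> K -> K) (D : set K)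
    (u : K -> K) : Prop :=
  open D /\
  forall t, D t ->
    [/\ derivable u t 1, derivable u^`() t 1, derivable u^`(2) t 1 &
        u^`(3) t = rhs (u t) (u^`() t)].

Definition jet (K : numClosedFieldType) (u : K -> K) (t : K) : 'I_3 -> K :=
  fun i => u^`(i) t.

Section RationalMaps.
Variables (K : fieldType) (n : nat).

Definition ratfun : fieldType := {fraction (mpoly n K)}.

Definition ratfun_of_poly (P : mpoly n K) : ratfun := tofrac P.

Definition ratconst (c : K) : ratfun := ratfun_of_poly (mpolyC n c).

Definition ratvar (i : 'I_n) : ratfun := ratfun_of_poly (mpolyX K (mnm1 i)).

(* y is the value at v of f; this requires f to be regular at v. *)
Definition has_value (f : ratfun) (v : 'I_n -> K) (y : K) : Prop :=
  exists N M : mpoly n K,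
    [/\ f = ratfun_of_poly N / ratfun_of_poly M,
        meval v M != 0 & y = meval v N / meval v M].

(* The partial derivative of a rational function, by the quotient rule applied
   to the representative chosen by repr. *)
Definition rderiv (i : 'I_n) (f : ratfun) : ratfun :=
  let N := \n_(repr f) in
  let M := \d_(repr f) in
  (ratfun_of_poly (mderiv i N) * ratfun_of_poly M
   - ratfun_of_poly N * ratfun_of_poly (mderiv i M))
  / ratfun_of_poly M ^+ 2.

Definition lie_derivative (X : 'I_n -> ratfun) (f : ratfun) : ratfun :=
  \sum_(i < n) X i * rderiv i f.

(* A rational map from affine n-space to itself is the n-tuple f of its
   components. *)
Definition subst_poly (f : 'I_n -> ratfun) (P : mpoly n K) : ratfun :=
  mmap ratconst f P.

(* The composite of the rational function g with the rational map f is defined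
   and equal to h. *)
Definition composite_is (f : 'I_n -> ratfun) (g h : ratfun) : Prop :=
  exists N M : mpoly n K,
    [/\ g = ratfun_of_poly N / ratfun_of_poly M,
        subst_poly f M != 0 & h = subst_poly f N / subst_poly f M].

Definition birational (f : 'I_n -> ratfun) : Prop :=
  exists g : 'I_n -> ratfun,
    (forall i, composite_is f (g i) (ratvar i)) /\
    (forall i, composite_is g (f i) (ratvar i)).

End RationalMaps.

(* The coordinates 0, 1, 2 of affine 3-space stand for u, u', u''.  The vector
   field is d/dt along the solutions of X.a. *)
Definition chazyXa_field (K : numClosedFieldType) (a : K) (i : 'I_3) :
    ratfun K 3 :=
  match val i with
  | 0%N => ratvar K (inord 1)
  | 1%N => ratvar K (inord 2)
  | _ => chazyXa_rhs (ratconst 3 (sqrtC 3)) (ratconst 3 a)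
           (ratvar K (inord 0)) (ratvar K (inord 1))
  end.

Definition g0_ratfun (K : numClosedFieldType) (a : K) : ratfun K 3 :=
  g0 (ratconst 3 (sqrtC 3)) (ratconst 3 a)
    (ratvar K (inord 0)) (ratvar K (inord 1)) (ratvar K (inord 2)).

(* (u, u', u'') |-> (p, p', p''), with u''' eliminated by means of X.a. *)
Definition g0_map (K : numClosedFieldType) (a : K) : 'I_3 -> ratfun K 3 :=
  fun i => iter i (lie_derivative (chazyXa_field a)) (g0_ratfun a).

(* Main.v *)
Require Import Defs.
From HB Require Import structures.
From mathcomp Require Import all_boot all_order all_algebra.
From mathcomp Require Import boolp classical_sets reals topology normedtype derive.
From mathcomp Require Import complex.
From mathcomp Require Import ring.
From mathcomp Require Import -(notations) mpoly.

Set Implicit Arguments.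
Unset Strict Implicit.
Unset Printing Implicit Defensive.

Import Order.TTheory GRing.Theory Num.Theory.
Import numFieldNormedType.Exports.
Local Open Scope ring_scope.
Local Open Scope classical_set_scope.

(** Let [s] be a square root of 3, let [d = (3 + s) u u' - u''] be the
    denominator of [g0], and put [v = u' - (3 + s)/2 u^2].  Then [v' = - d], and
    X.a turns out to say that [d' = - (3 + s) u d + C(v)], where [C] is a
    quadratic polynomial in [v] alone, with coefficients in [s] and [alpha]
    ([chazyXaE]).  So X.a is the system
      [u' = v + (3 + s)/2 u^2,  v' = - d,  d' = - (3 + s) u d + C(v)],
    and in the coordinates [u, v, d] the transformation is
      [p = (2 + s) u - (3 + s)/3 C(v)/d]    ([g0E]).

    Equation X.b is X.a with [s] replaced by [- s].  Let [w, e, B] be made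
    from [p] and [- s] as [v, d, C] are made from [u] and [s].  In the
    derivative of [p] almost everything cancels, and what is left is
      [w = lambda v + mu alpha],  [lambda = (14 - 5 s)/11],  [mu = (3 - 5 s)/66]
    ([deriv_g0_normal]).  Differentiating once more, [e = lambda d].  Moreover
    [B(w) = - lambda C(v)] ([chazy_quad_conj]).  With these three relations the
    formula for [p] can be read in two ways.  It says that
    [e' = - (3 - s) p e + B(w)], which is X.b ([chazyXb_normal]); and, solved
    for [u], it reads [u = (2 - s) p - (3 - s)/3 B(w)/e], so that the same
    transformation with [- s] in place of [s] sends [(p, p', p'')] back to
    [(u, u', u'')] ([g0K], [g0_d1K], [g0_d2K]).  Hence the map is birational.

    The derivatives of [p] are needed for functions of a complex variable
    ([chazyXb_of_chazyXa]) and for the derivation of the field of rational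
    functions that expresses [d/dt] along X.a ([derivation_g0],
    [derivation_g0_d1]); both follow from the rules of differentiation and the
    identities above.  The formal side rests on two facts.  The quotient rule
    gives the same result for all representatives of a fraction
    ([rderiv_frac]), which makes the partial derivatives derivations.  And the
    value of a rational function at a point and its composite with a rational
    map are both obtained by applying a ring morphism of the polynomial ring to
    numerator and denominator; [frac_value] treats the two at once, so that one
    lemma, [frac_value_g0_jet_map], computes the map at the jet of a solution
    and its composite with its inverse. *)

(** * Normal form of the transformation *)

Definition chazy_v {F : fieldType} (s u u1 : F) : F := u1 - (3 + s) / 2 * u ^+ 2.

(** The polynomial [C] of the normal form of X.a. *)
Definition chazy_quad {F : fieldType} (s a v : F) : F :=
  2 * (3 - 5 * s) / 11 * v ^+ 2 + (4 - 3 * s) / 22 * a * v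
  + (9 + 7 * s) / 352 * a ^+ 2.

Definition chazy_dquad {F : fieldType} (s a v : F) : F :=
  4 * (3 - 5 * s) / 11 * v + (4 - 3 * s) / 22 * a.

(** The passage from [u] and [s] to [p] and [- s] multiplies the denominator by
    [conj_scale s], and acts on [v] by [conj_affine]. *)
Definition conj_scale {F : fieldType} (s : F) : F := (14 - 5 * s) / 11.

Definition conj_affine {F : fieldType} (s a v : F) : F :=
  conj_scale s * v + (3 - 5 * s) / 66 * a.

(** The derivative of [g0] along X.a, in a form that shows that
    [p' - (3 - s)/2 p^2] is affine in [v]. *)
Definition g0_d1 {F : fieldType} (s a u u1 u2 : F) : F :=
  conj_affine s a (chazy_v s u u1) + (3 - s) / 2 * g0 s a u u1 u2 ^+ 2.

(** The derivative of [g0_d1] along X.a: the term [- conj_scale s * d] is the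
    derivative of [conj_affine]. *)
Definition g0_d2 {F : fieldType} (s a u u1 u2 : F) : F :=
  (3 - s) * g0 s a u u1 u2 * g0_d1 s a u u1 u2 - conj_scale s * g0_den s u u1 u2.

Section Algebra.
Variables (F : fieldType) (s a : F).
Hypotheses (s2 : s ^+ 2 = 3) (nz : 1056%:R != 0 :> F).

(** All the integer denominators of the formulas divide [1056 = 2^5 * 3 * 11]. *)
Lemma natr_neq0_of_dvd n : (n %| 1056)%N -> n%:R != 0 :> F.
Proof.
move=> /dvdnP[m e]; apply: contraNneq nz => n0.
by rewrite e natrM n0 mulr0.
Qed.

(** The first term is the derivative of [(3 + s) u u'], so this says that
    [d' = - (3 + s) u d + C(v)]; the point is that what is left of the equation
    is a function of [v]. *)
Lemma chazyXaE u u1 u2 :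
  chazyXa_rhs s a u u1
  = (3 + s) * (u1 ^+ 2 + u * u2) + (3 + s) * u * g0_den s u u1 u2
    - chazy_quad s a (chazy_v s u u1).
Proof.
rewrite /chazyXa_rhs /chazy_quad /chazy_v /g0_den; field: s2.
by rewrite !natr_neq0_of_dvd.
Qed.

(** Eliminating [u''] in favour of [d] makes the numerator of [g0] the sum of a
    multiple of [u d] and of a polynomial in [u], [u'] that is proportional to
    [C(v)]. *)
Lemma g0E u u1 u2 : g0_den s u u1 u2 != 0 ->
  g0 s a u u1 u2
  = (2 + s) * u - (3 + s) / 3 * (chazy_quad s a (chazy_v s u u1) / g0_den s u u1 u2).
Proof.
rewrite /g0; set d := g0_den _ _ _ _ => dn0.
have -> : u2 = (3 + s) * u * u1 - d by rewrite /d /g0_den; ring.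
rewrite /chazy_quad /chazy_v; field: s2.
by rewrite dn0 !natr_neq0_of_dvd.
Qed.

(** The left side is [p'] computed from [g0E] by the rules of differentiation,
    with [v' = - d] and [d' = C(v) - (3 + s) u d].  The terms in [u^2], [u C(v)/d]
    and [(C(v)/d)^2] of [p'] are those of [(3 - s)/2 p^2]. *)
Lemma deriv_g0_normal u u1 u2 : g0_den s u u1 u2 != 0 ->
  let v := chazy_v s u u1 in
  let d := g0_den s u u1 u2 in
  (2 + s) * u1
  - (3 + s) / 3 * ((chazy_dquad s a v * (- d) * d
                    - chazy_quad s a v * (chazy_quad s a v - (3 + s) * u * d)) / d ^+ 2)
  = g0_d1 s a u u1 u2.
Proof.
move=> dn0; rewrite /= /g0_d1 g0E //.
set v := chazy_v _ _ _; set d := g0_den _ _ _ _ in dn0 *.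
have -> : u1 = v + (3 + s) / 2 * u ^+ 2 by rewrite /v /chazy_v; ring.
rewrite /conj_affine /conj_scale /chazy_quad /chazy_dquad; field: s2.
by rewrite dn0 !natr_neq0_of_dvd.
Qed.

Lemma chazy_quad_conj v :
  chazy_quad (- s) a (conj_affine s a v) = - conj_scale s * chazy_quad s a v.
Proof.
rewrite /chazy_quad /conj_affine /conj_scale; field: s2.
by rewrite !natr_neq0_of_dvd.
Qed.

Lemma conj_affineK v : conj_affine (- s) a (conj_affine s a v) = v.
Proof.
rewrite /conj_affine /conj_scale; field: s2.
by rewrite !natr_neq0_of_dvd.
Qed.

Lemma conj_scaleK : conj_scale (- s) * conj_scale s = 1 :> F.
Proof.
rewrite /conj_scale; field: s2.
by rewrite !natr_neq0_of_dvd.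
Qed.

Lemma conj_scale_neq0 : conj_scale s != 0 :> F.
Proof. by apply: contra_eq_neq conj_scaleK => ->; rewrite mulr0 eq_sym oner_eq0. Qed.

Lemma g0_den_conj u u1 u2 :
  g0_den (- s) (g0 s a u u1 u2) (g0_d1 s a u u1 u2) (g0_d2 s a u u1 u2)
  = conj_scale s * g0_den s u u1 u2.
Proof. by rewrite /g0_d2 /g0_den; ring. Qed.

Lemma chazy_v_conj u u1 u2 :
  chazy_v (- s) (g0 s a u u1 u2) (g0_d1 s a u u1 u2) = conj_affine s a (chazy_v s u u1).
Proof. by rewrite {1}/chazy_v {1}/g0_d1; ring. Qed.

Lemma chazyXb_conj p p1 : chazyXb_rhs s a p p1 = chazyXa_rhs (- s) a p p1.
Proof. by rewrite /chazyXb_rhs /chazyXa_rhs; ring. Qed.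
End Algebra.

(** Here [p], [p1], [p2] stand for [p], [p'], [p'']; the lemmas read the normal
    form with [- s] at the jet of [p]. *)
Section Conjugation.
Variables (F : fieldType) (s a : F).
Hypotheses (s2 : s ^+ 2 = 3) (nz : 1056%:R != 0 :> F).
Variables (u u1 u2 : F).
Hypothesis dn0 : g0_den s u u1 u2 != 0.
Let p := g0 s a u u1 u2.
Let p1 := g0_d1 s a u u1 u2.
Let p2 := g0_d2 s a u u1 u2.
Let ms2 : (- s) ^+ 2 = 3. Proof. by rewrite sqrrN. Qed.

Lemma g0_den_conj_neq0 : g0_den (- s) p p1 p2 != 0.
Proof. by rewrite g0_den_conj mulf_neq0 // conj_scale_neq0. Qed.

Lemma g0K : g0 (- s) a p p1 p2 = u.
Proof.
rewrite g0E ?g0_den_conj_neq0 // chazy_v_conj g0_den_conj chazy_quad_conj //.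
have ln0 := conj_scale_neq0 s2 nz.
rewrite /p g0E //; set C := chazy_quad _ _ _; move: dn0; set d := g0_den _ _ _ _ => d0.
field: s2.
by rewrite d0 ln0 (natr_neq0_of_dvd nz).
Qed.

Lemma g0_d1K : g0_d1 (- s) a p p1 p2 = u1.
Proof. by rewrite /g0_d1 g0K chazy_v_conj conj_affineK // /chazy_v; ring. Qed.

Lemma g0_d2K : g0_d2 (- s) a p p1 p2 = u2.
Proof.
by rewrite /g0_d2 g0K g0_d1K g0_den_conj mulrA conj_scaleK // /g0_den; ring.
Qed.

(** The left side is the derivative of [g0_d2] along X.a. *)
Lemma chazyXb_normal :
  (3 - s) * (p1 ^+ 2 + p * p2)
  - conj_scale s * (chazy_quad s a (chazy_v s u u1) - (3 + s) * u * g0_den s u u1 u2)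
  = chazyXb_rhs s a p p1.
Proof.
rewrite chazyXb_conj (chazyXaE _ ms2 nz _ _ p2) chazy_v_conj g0_den_conj chazy_quad_conj //.
rewrite {3}/p g0E //; set C := chazy_quad _ _ _; move: dn0; set d := g0_den _ _ _ _ => d0.
field: s2.
by rewrite d0 (natr_neq0_of_dvd nz).
Qed.
End Conjugation.

(** * Solutions of the differential equations *)

Section Deriv.
Variable K : numFieldType.
Implicit Types (f g : K -> K) (t df dg : K).

Lemma is_derive_add f g t df dg : is_derive t 1 f df -> is_derive t 1 g dg ->
  is_derive t 1 (fun x => f x + g x) (df + dg).
Proof. exact: is_deriveD. Qed.

Lemma is_derive_sub f g t df dg : is_derive t 1 f df -> is_derive t 1 g dg ->
  is_derive t 1 (fun x => f x - g x) (df - dg).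
Proof. exact: is_deriveB. Qed.

Lemma is_derive_mul f g t df dg : is_derive t 1 f df -> is_derive t 1 g dg ->
  is_derive t 1 (fun x => f x * g x) (df * g t + f t * dg).
Proof.
by move=> hf hg; apply: is_derive_eq; rewrite addrC [df * _]mulrC.
Qed.

Lemma is_derive_scale (c : K) f t df : is_derive t 1 f df ->
  is_derive t 1 (fun x => c * f x) (c * df).
Proof. exact: is_deriveZ. Qed.

Lemma is_derive_div f g t df dg : g t != 0 ->
  is_derive t 1 f df -> is_derive t 1 g dg ->
  is_derive t 1 (fun x => f x / g x) ((df * g t - f t * dg) / g t ^+ 2).
Proof.
move=> g0 hf [hg eg].
have hV : is_derive t 1 (fun x => (g x)^-1) (- (g t) ^- 2 * dg).
  by split; [exact: derivableV | rewrite deriveV // eg].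
apply: (is_derive_eq (is_derive_mul hf hV)).
by field.
Qed.

Lemma is_derive1P f t df :
  is_derive t 1 f df <-> derivable f t 1 /\ f^`() t = df.
Proof. by rewrite derive1E; split=> [[]|[]]. Qed.

Lemma is_derive_continuous f t df : is_derive t 1 f df -> {for t, continuous f}.
Proof. by move=> [h _]; apply/differentiable_continuous/derivable1_diffP. Qed.
End Deriv.

(** A function given by a formula is shown to solve a third order equation by
    exhibiting its derivatives as formulas: on an open set these agree with the
    iterated derivatives near each point, hence can be differentiated in their
    place. *)
Lemma solves_chain (K : numClosedFieldType) (rhs : K -> K -> K) (D : set K)
    (f f1 f2 : K -> K) :
  open D ->
  (forall t, D t -> [/\ is_derive t 1 f (f1 t), is_derive t 1 f1 (f2 t)
     & is_derive t 1 f2 (rhs (f t) (f1 t))]) ->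
  solves rhs D f /\ forall t, D t -> f^`() t = f1 t /\ f^`(2) t = f2 t.
Proof.
move=> Dop H.
have tr (g h : K -> K) (dh t : K) : (forall x, D x -> g x = h x) -> D t ->
    is_derive t 1 h dh -> is_derive t 1 g dh.
  move=> gh Dt; apply: near_eq_is_derive.
  have : \forall x \near t, D x by exact: open_nbhs_nbhs.
  by apply: filterS => x /gh.
have e1 t : D t -> f^`() t = f1 t.
  by move=> Dt; have [/is_derive1P[]] := H t Dt.
have H1 t : D t -> is_derive t 1 f^`() (f2 t).
  by move=> Dt; apply: (tr _ _ _ _ e1 Dt); case: (H t Dt).
have e2 t : D t -> f^`(2) t = f2 t by move=> /H1 /is_derive1P[].
have H2 t : D t -> is_derive t 1 f^`(2) (rhs (f t) (f1 t)).
  by move=> Dt; apply: (tr _ _ _ _ e2 Dt); case: (H t Dt).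
split; last by move=> t Dt; rewrite e1 ?e2.
split=> // t Dt; split.
- by case: (H t Dt) => -[].
- by case: (H1 t Dt).
- by case: (H2 t Dt).
- by rewrite e1 //; have /is_derive1P[] := H2 t Dt.
Qed.

Lemma numField_1056_neq0 (K : numFieldType) : 1056%:R != 0 :> K.
Proof. by rewrite pnatr_eq0. Qed.

Section Chain.
Variables (K : numClosedFieldType) (s a : K) (D : set K) (u : K -> K).
Hypothesis s2 : s ^+ 2 = 3.
Hypothesis sol : solves (chazyXa_rhs s a) D u.
Local Notation u1 := u^`().
Local Notation u2 := u^`(2).
Local Notation d := (fun t => g0_den s (u t) (u1 t) (u2 t)).
Local Notation v := (fun t => chazy_v s (u t) (u1 t)).
Local Notation C := (fun t => chazy_quad s a (v t)).
Local Notation D' := [set t | D t /\ d t != 0].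
Local Notation p0 := (fun t => g0 s a (u t) (u1 t) (u2 t)).
Local Notation p1 := (fun t => g0_d1 s a (u t) (u1 t) (u2 t)).
Local Notation p2 := (fun t => g0_d2 s a (u t) (u1 t) (u2 t)).

Let dnat := @numField_1056_neq0 K.

Lemma sol_is_derive t : D t -> [/\ is_derive t 1 u (u1 t),
  is_derive t 1 u1 (u2 t) & is_derive t 1 u2 (chazyXa_rhs s a (u t) (u1 t))].
Proof.
move=> Dt; have [_ /(_ t Dt)[d0 d1 d2 e]] := sol.
split; apply/is_derive1P;
  [exact: (conj d0 erefl) | exact: (conj d1 erefl) | exact: (conj d2 e)].
Qed.

Lemma is_derive_v t : D t -> is_derive t 1 v (- d t).
Proof.
move=> /sol_is_derive[h0 h1 h2].
apply: (is_derive_eq (is_derive_sub h1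
  (is_derive_scale ((3 + s) / 2) (is_derive_mul h0 h0)))).
by rewrite /g0_den; field.
Qed.

Lemma is_derive_den t : D t -> is_derive t 1 d (C t - (3 + s) * u t * d t).
Proof.
move=> /sol_is_derive[h0 h1 h2].
apply: (is_derive_eq (is_derive_sub (is_derive_mul (is_derive_scale (3 + s) h0) h1) h2)).
by rewrite (chazyXaE _ s2 dnat _ _ (u2 t)) /g0_den; ring.
Qed.

Lemma is_derive_C t : D t -> is_derive t 1 C (chazy_dquad s a (v t) * - d t).
Proof.
move=> /is_derive_v hv.
have hvv := is_derive_scale (2 * (3 - 5 * s) / 11) (is_derive_mul hv hv).
have hl := is_derive_scale ((4 - 3 * s) / 22 * a) hv.
have hc := is_derive_cst ((9 + 7 * s) / 352 * a ^+ 2) t (1 : K).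
apply: (is_derive_eq (is_derive_add (is_derive_add hvv hl) hc)).
by rewrite /chazy_dquad; field.
Qed.

(** The denominator is differentiable, hence continuous, on [D]. *)
Lemma open_D' : open D'.
Proof.
rewrite openE => t [Dt dn0]; apply: filterI.
  by case: sol => Dop _; apply: open_nbhs_nbhs.
have /is_derive_continuous hd := is_derive_den Dt.
exact: cvgr_neq0 hd dn0.
Qed.

Lemma is_derive_g0 t : D' t -> is_derive t 1 p0 (p1 t).
Proof.
move=> Dt0; have [Dt dn0] := Dt0; have [h0 _ _] := sol_is_derive Dt.
pose q x := (2 + s) * u x - (3 + s) / 3 * (C x / d x).
apply: (@near_eq_is_derive _ _ _ q).
  have : \forall x \near t, D' x by apply: open_nbhs_nbhs; split=> //; exact: open_D'.
  by apply: filterS => x [_ dx]; rewrite g0E.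
have hq := @is_derive_div K C d t _ _ dn0 (is_derive_C Dt) (is_derive_den Dt).
apply: (is_derive_eq (is_derive_sub (is_derive_scale (2 + s) h0)
  (is_derive_scale ((3 + s) / 3) hq))).
exact: deriv_g0_normal.
Qed.

Lemma is_derive_g0_d1 t : D' t -> is_derive t 1 p1 (p2 t).
Proof.
move=> Dt0; have [Dt _] := Dt0.
have hv := is_derive_scale (conj_scale s) (is_derive_v Dt).
have hc := is_derive_cst ((3 - 5 * s) / 66 * a) t (1 : K).
have hp := is_derive_g0 Dt0.
have hpp := is_derive_scale ((3 - s) / 2) (is_derive_mul hp hp).
apply: (is_derive_eq (is_derive_add (is_derive_add hv hc) hpp)).
by rewrite /g0_d2; field.
Qed.

Lemma is_derive_g0_d2 t : D' t -> is_derive t 1 p2 (chazyXb_rhs s a (p0 t) (p1 t)).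
Proof.
move=> Dt0; have [Dt dn0] := Dt0.
have h0 := is_derive_g0 Dt0; have h1 := is_derive_g0_d1 Dt0.
have hd := is_derive_den Dt.
apply: (is_derive_eq (is_derive_sub
  (is_derive_mul (is_derive_scale (3 - s) h0) h1) (is_derive_scale (conj_scale s) hd))).
by rewrite -chazyXb_normal //; ring.
Qed.

Lemma chazyXb_of_chazyXa : solves (chazyXb_rhs s a) D' p0 /\
  forall t, D' t -> p0^`() t = p1 t /\ p0^`(2) t = p2 t.
Proof.
apply: solves_chain; first exact: open_D'.
by move=> t Dt0; split; [exact: is_derive_g0|exact: is_derive_g0_d1|exact: is_derive_g0_d2].
Qed.
End Chain.

(** * Rational functions and their derivations *)

(** [dN], [dM], [dN'], [dM'] stand for the derivatives of numerators and
    denominators of two fractions [N / M] and [N' / M'].  The field is abstract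
    so that [field] sees no concrete fractions to unfold. *)
Section FieldIdentities.
Variables (F : fieldType) (N M dN dM N' M' dN' dM' : F).
Hypotheses (M0 : M != 0) (M0' : M' != 0).

Lemma quotient_rule_repr : N' = N * M' / M ->
  dN' = (dN * M' + N * dM' - N' * dM) / M ->
  (dN' * M' - N' * dM') / M' ^+ 2 = (dN * M - N * dM) / M ^+ 2.
Proof. by move=> -> ->; field; rewrite M0 M0'. Qed.

Lemma quotient_ruleD :
  (((dN * M' + N * dM') + (dN' * M + N' * dM)) * (M * M')
   - (N * M' + N' * M) * (dM * M' + M * dM')) / (M * M') ^+ 2
  = (dN * M - N * dM) / M ^+ 2 + (dN' * M' - N' * dM') / M' ^+ 2.
Proof. by field; rewrite M0 M0'. Qed.

Lemma quotient_ruleM :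
  ((dN * N' + N * dN') * (M * M') - N * N' * (dM * M' + M * dM')) / (M * M') ^+ 2
  = (dN * M - N * dM) / M ^+ 2 * (N' / M') + N / M * ((dN' * M' - N' * dM') / M' ^+ 2).
Proof. by field; rewrite M0 M0'. Qed.
End FieldIdentities.

Section RationalFunctions.
Variables (K : fieldType) (n : nat).
Local Notation P := (mpoly n K).
Local Notation RF := (ratfun K n).
Local Notation "x %:F" := (@ratfun_of_poly K n x).

Lemma ratfunD (N M : P) : (N + M)%:F = N%:F + M%:F.
Proof. exact: tofracD. Qed.
Lemma ratfunB (N M : P) : (N - M)%:F = N%:F - M%:F.
Proof. exact: tofracB. Qed.
Lemma ratfunM (N M : P) : (N * M)%:F = N%:F * M%:F.
Proof. exact: tofracM. Qed.
Lemma ratfun1 : (1 : P)%:F = 1.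
Proof. exact: tofrac1. Qed.
Lemma ratfun_eq0 (N : P) : (N%:F == 0) = (N == 0).
Proof. exact: tofrac_eq0. Qed.
Lemma ratfun_inj (N M : P) : N%:F = M%:F -> N = M.
Proof. by move/eqP; rewrite tofrac_eq => /eqP. Qed.

(** A rational function is the fraction that [repr] chooses for it, which gives
    access to [rderiv]. *)
Lemma ratfun_numden (f : RF) : f = (\n_(repr f))%:F / (\d_(repr f))%:F.
Proof.
have dn0 := denom_ratioP (repr f).
apply: (canRL (mulfK _)); first by rewrite ratfun_eq0.
rewrite -[in LHS](reprK f) /ratfun_of_poly; unlock FracField.tofrac.
set x := repr f in dn0 *.
rewrite -[LHS]FracField.pi_mul; apply/eqmodP => /=.
by rewrite FracField.equivfE /FracField.mulf !numden_Ratio ?mulr1 ?oner_neq0 // reprK mulrC.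
Qed.

(** If [N / M = N' / M'], then differentiating [N M' = N' M] expresses the
    derivative of [N'] by those of [N], [M], [M'], and the two quotient rules
    agree. *)
Lemma rderiv_frac i (N M : P) : M != 0 ->
  rderiv i (N%:F / M%:F)
  = ((mderiv i N)%:F * M%:F - N%:F * (mderiv i M)%:F) / M%:F ^+ 2.
Proof.
move=> M0; set f := N%:F / M%:F; rewrite /rderiv.
have := ratfun_numden f; have := denom_ratioP (repr f).
move: (\n_(repr f)) (\d_(repr f)) => n' d' d0; rewrite {}/f => e.
have M0' : M%:F != 0 by rewrite ratfun_eq0.
have d0' : d'%:F != 0 by rewrite ratfun_eq0.
have eP : N * d' = n' * M.
  by apply: ratfun_inj; rewrite !ratfunM; apply/eqP; rewrite -eqr_div // e.
have eD := congr1 (fun Q => (mderiv i Q)%:F) eP.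
rewrite !mderivM !ratfunD !ratfunM in eD.
have eN : n'%:F = N%:F * d'%:F / M%:F.
  by rewrite -ratfunM eP ratfunM mulfK.
have eDn : (mderiv i n')%:F = ((mderiv i N)%:F * d'%:F + N%:F * (mderiv i d')%:F
   - n'%:F * (mderiv i M)%:F) / M%:F.
  by rewrite eD addrK mulfK.
exact: quotient_rule_repr eN eDn.
Qed.

Variant frac_spec : RF -> Type :=
  FracSpec (N M : P) of M != 0 : frac_spec (N%:F / M%:F).
Lemma fracP f : frac_spec f.
Proof. by rewrite (ratfun_numden f); constructor; exact: denom_ratioP. Qed.

Lemma rderivD i (f g : RF) : rderiv i (f + g) = rderiv i f + rderiv i g.
Proof.
case: (fracP f) (fracP g) => N M M0 [N' M' M0'].
have h0 : M%:F != 0 by rewrite ratfun_eq0.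
have h0' : M'%:F != 0 by rewrite ratfun_eq0.
rewrite addf_div // -!ratfunM -ratfunD !rderiv_frac ?mulf_neq0 //.
by rewrite mderivD !mderivM !(ratfunD, ratfunM) quotient_ruleD.
Qed.

Lemma rderivM i (f g : RF) : rderiv i (f * g) = rderiv i f * g + f * rderiv i g.
Proof.
case: (fracP f) (fracP g) => N M M0 [N' M' M0'].
have h0 : M%:F != 0 by rewrite ratfun_eq0.
have h0' : M'%:F != 0 by rewrite ratfun_eq0.
rewrite mulf_div -!ratfunM !rderiv_frac ?mulf_neq0 //.
by rewrite !mderivM !(ratfunD, ratfunM) quotient_ruleM.
Qed.

Lemma rderiv_poly i (N : P) : rderiv i N%:F = (mderiv i N)%:F.
Proof.
have -> : N%:F = N%:F / (1 : P)%:F by rewrite [X in _ / X]tofrac1 divr1.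
rewrite rderiv_frac ?oner_neq0 // -[1%R]/(mpolyC n 1) mderivC.
by rewrite [(mpolyC n 1)%:F]tofrac1 [(0 : P)%:F]tofrac0 mulr0 subr0 expr1n !divr1 mulr1.
Qed.

Lemma rderiv_var (i j : 'I_n) : rderiv i (ratvar K j) = (i == j)%:R.
Proof.
rewrite rderiv_poly mderivX mnm1E eq_sym; case: eqP => [->|_].
  rewrite scale1r (_ : mnm_sub (mnm1 j) (mnm1 j) = @mnm0 n) ?mpolyX0 ?[LHS]tofrac1 //.
  by apply/mnmP => k; rewrite mnmBE subnn mnm0E.
by rewrite scale0r [LHS]tofrac0.
Qed.

Section Lie.
Variable X : 'I_n -> RF.
Local Notation L := (lie_derivative X).

Lemma lieD f g : L (f + g) = L f + L g.
Proof.
by rewrite -big_split /=; apply: eq_bigr => i _; rewrite rderivD mulrDr.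
Qed.

Lemma lieM f g : L (f * g) = L f * g + f * L g.
Proof.
rewrite mulr_suml mulr_sumr -big_split /=; apply: eq_bigr => i _.
by rewrite rderivM mulrDr !mulrA [X i * f]mulrC.
Qed.

Lemma lie_const c : L (ratconst n c) = 0.
Proof.
by rewrite /lie_derivative big1 // => i _; rewrite rderiv_poly mderivC [_%:F]tofrac0 mulr0.
Qed.

Lemma lie_var i : L (ratvar K i) = X i.
Proof.
rewrite /lie_derivative (bigD1 i) //= rderiv_var eqxx mulr1 big1 ?addr0 // => j ji.
by rewrite rderiv_var (negPf ji) mulr0.
Qed.

End Lie.

(** For a morphism [phi] into a field, [frac_value phi] is the graph of its
    extension to the fractions whose denominator is not killed by [phi].  With
    [phi] the evaluation at a point it is [has_value], and with [phi] the
    substitution of a rational map it is [composite_is]. *)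
Section FracValue.
Variables (L : fieldType) (phi : {rmorphism P -> L}).

Definition frac_value (f : RF) (y : L) : Prop :=
  exists N M : P, [/\ f = N%:F / M%:F, phi M != 0 & y = phi N / phi M].

Lemma frac_value_poly N : frac_value N%:F (phi N).
Proof. by exists N, 1; rewrite rmorph1 oner_neq0 ratfun1 !divr1. Qed.

Let den0 N : phi N != 0 -> N%:F != 0.
Proof. by rewrite ratfun_eq0; apply: contraNneq => ->; rewrite rmorph0. Qed.

Lemma frac_valueD f g y z :
  frac_value f y -> frac_value g z -> frac_value (f + g) (y + z).
Proof.
move=> [N [M [-> M0 ->]]] [N' [M' [-> M0' ->]]].
exists (N * M' + N' * M), (M * M'); rewrite rmorphM mulf_neq0 //; split=> //.
  by rewrite addf_div ?den0 // !(ratfunD, ratfunM).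
by rewrite addf_div // rmorphD !rmorphM.
Qed.

Lemma frac_valueM f g y z :
  frac_value f y -> frac_value g z -> frac_value (f * g) (y * z).
Proof.
move=> [N [M [-> M0 ->]]] [N' [M' [-> M0' ->]]].
exists (N * N'), (M * M'); rewrite rmorphM mulf_neq0 //; split=> //.
  by rewrite mulf_div !ratfunM.
by rewrite mulf_div !rmorphM.
Qed.

Lemma frac_valueV f y : y != 0 -> frac_value f y -> frac_value f^-1 y^-1.
Proof.
move=> y0 [N [M [ef M0 ey]]]; exists M, N; rewrite ef ey !invf_div; split=> //.
by apply: contraNneq y0 => N0; rewrite ey N0 mul0r.
Qed.

Lemma frac_value_neq0 f y : frac_value f y -> y != 0 -> f != 0.
Proof.
move=> [N [M [-> M0 ->]]] y0; have N0 : phi N != 0.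
  by apply: contraNneq y0 => ->; rewrite mul0r.
by apply: mulf_neq0; [exact: den0 | apply: invr_neq0; exact: den0].
Qed.

Lemma frac_value_nat m : frac_value m%:R m%:R.
Proof.
rewrite -(rmorph_nat phi) (_ : m%:R = (m%:R)%:F) ?[RHS]rmorph_nat //.
exact: frac_value_poly.
Qed.

Lemma frac_valueN f y : frac_value f y -> frac_value (- f) (- y).
Proof.
move=> [N [M [-> M0 ->]]]; exists (- N), M; split=> //.
  by rewrite -mulNr; congr (_ / _); rewrite [RHS]tofracN.
by rewrite rmorphN mulNr.
Qed.

Lemma frac_valueB f g y z :
  frac_value f y -> frac_value g z -> frac_value (f - g) (y - z).
Proof. by move=> hf hg; apply: frac_valueD => //; apply: frac_valueN. Qed.

Lemma frac_valueX f y m : frac_value f y -> frac_value (f ^+ m) (y ^+ m).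
Proof.
move=> hf; elim: m => [|m IH]; first exact: (frac_value_nat 1).
by rewrite !exprS; apply: frac_valueM.
Qed.

Lemma frac_value_div f g y z : z != 0 ->
  frac_value f y -> frac_value g z -> frac_value (f / g) (y / z).
Proof. by move=> z0 hf hg; apply: frac_valueM => //; apply: frac_valueV. Qed.
End FracValue.
End RationalFunctions.

(** These identities are stated for a derivation of an arbitrary field: the
    vector field of X.a on rational functions is the instance of interest. *)
Section Derivation.
Variables (F : fieldType) (L : F -> F).
Hypotheses (LD : forall f g, L (f + g) = L f + L g)
           (LM : forall f g, L (f * g) = L f * g + f * L g).

Lemma derivation1 : L 1 = 0.
Proof. by have := LM 1 1; rewrite !mulr1 mul1r -{1}[L 1]addr0 => /addrI. Qed.

Lemma derivation0 : L 0 = 0.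
Proof. by apply: (addrI (L 0)); rewrite -LD !addr0. Qed.

Lemma derivationN f : L (- f) = - L f.
Proof. by apply/eqP; rewrite -addr_eq0 -LD addNr derivation0. Qed.

Lemma derivation_nat n : L n%:R = 0.
Proof.
by elim: n => [|n IH]; rewrite ?derivation0 // mulrS LD derivation1 IH addr0.
Qed.

Lemma derivationX2 f : L (f ^+ 2) = 2 * f * L f.
Proof. by rewrite expr2 LM; ring. Qed.

Lemma derivation_div f g : g != 0 -> L (f / g) = (L f * g - f * L g) / g ^+ 2.
Proof.
move=> g0; have := LM (f / g) g; rewrite divfK // => ->.
by field.
Qed.

Lemma derivation_natV n : L n%:R^-1 = 0.
Proof.
have [->|n0] := eqVneq (n%:R : F) 0; first by rewrite invr0 derivation0.
rewrite -[X in L X]mul1r derivation_div // derivation1 derivation_nat.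
by rewrite mul0r mulr0 subr0 mul0r.
Qed.

Let derivationE :=
  (LD, derivationN, LM, derivation1, derivation_nat, derivation_natV, derivationX2).

Variables (s a u u1 u2 : F).
Hypotheses (s2 : s ^+ 2 = 3) (nz : 1056%:R != 0 :> F).
Hypotheses (Ls : L s = 0) (La : L a = 0).
Hypotheses (Lu : L u = u1) (Lu1 : L u1 = u2) (Lu2 : L u2 = chazyXa_rhs s a u u1).
Let v := chazy_v s u u1.
Let d := g0_den s u u1 u2.

Lemma derivation_v : L v = - d.
Proof.
rewrite /v /chazy_v !derivationE Ls Lu Lu1 /d /g0_den; field.
by rewrite (natr_neq0_of_dvd nz).
Qed.

Lemma derivation_den : L d = chazy_quad s a v - (3 + s) * u * d.
Proof.
rewrite /d {1}/g0_den !derivationE Ls Lu Lu1 Lu2.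
by rewrite (chazyXaE _ s2 nz _ _ u2) -/v -/d /d /g0_den; ring.
Qed.

Lemma derivation_C w : L (chazy_quad s a w) = chazy_dquad s a w * L w.
Proof.
rewrite /chazy_quad !derivationE Ls La /chazy_dquad; field.
by rewrite !(natr_neq0_of_dvd nz).
Qed.

Hypothesis dn0 : d != 0.

Lemma derivation_g0 : L (g0 s a u u1 u2) = g0_d1 s a u u1 u2.
Proof.
rewrite g0E // -deriv_g0_normal //= -/d -/v.
have -> : L ((2 + s) * u - (3 + s) / 3 * (chazy_quad s a v / d))
    = (2 + s) * L u - (3 + s) / 3 * L (chazy_quad s a v / d).
  move: (chazy_quad s a v / d) => w; rewrite !derivationE Ls; field.
  by rewrite (natr_neq0_of_dvd nz).
by rewrite derivation_div // derivation_C derivation_v derivation_den Lu.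
Qed.

Lemma derivation_g0_d1 : L (g0_d1 s a u u1 u2) = g0_d2 s a u u1 u2.
Proof.
rewrite /g0_d2 -{2}derivation_g0 -/d -[d]opprK -derivation_v.
rewrite /g0_d1 /conj_affine /conj_scale -/v.
move: v (g0 _ _ _ _ _) => w p; rewrite !derivationE Ls La; field.
by rewrite !(natr_neq0_of_dvd nz).
Qed.
End Derivation.

Section ComposedValues.
Variables (K : fieldType) (n : nat) (E : fieldType).
Variable phi : {rmorphism mpoly n K -> E}.

(** The lemma is chosen by the operation that is written: choosing it by
    unification would unfold the operations of the field of fractions. *)
Ltac frac_values := repeat lazymatch goal with
  | |- frac_value _ (_ / _) _ => apply: frac_value_div
  | |- frac_value _ (_ * _) _ => apply: frac_valueM
  | |- frac_value _ (_ + - _) _ => apply: frac_valueB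
  | |- frac_value _ (_ + _) _ => apply: frac_valueD
  | |- frac_value _ (- _) _ => apply: frac_valueN
  | |- frac_value _ (_ ^+ _) _ => apply: frac_valueX
  | |- frac_value _ (_ *+ _) _ => exact: frac_value_nat
  | |- frac_value _ _ _ => assumption
  end.

Variables (s a x0 x1 x2 : ratfun K n) (s' a' y0 y1 y2 : E).
Hypotheses (hs : frac_value phi s s') (ha : frac_value phi a a').
Hypotheses (h0 : frac_value phi x0 y0) (h1 : frac_value phi x1 y1)
  (h2 : frac_value phi x2 y2).
Hypotheses (nz : 1056%:R != 0 :> E) (dn0 : g0_den s' y0 y1 y2 != 0).

Lemma frac_value_den : frac_value phi (g0_den s x0 x1 x2) (g0_den s' y0 y1 y2).
Proof. by rewrite /g0_den; frac_values. Qed.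

Lemma frac_value_g0 : frac_value phi (g0 s a x0 x1 x2) (g0 s' a' y0 y1 y2).
Proof.
have hd := frac_value_den.
rewrite /g0; frac_values.
by rewrite mulf_neq0.
Qed.

Lemma frac_value_g0_d1 : frac_value phi (g0_d1 s a x0 x1 x2) (g0_d1 s' a' y0 y1 y2).
Proof.
have hg := frac_value_g0.
rewrite /g0_d1 /conj_affine /conj_scale /chazy_v; frac_values;
  by rewrite (natr_neq0_of_dvd nz).
Qed.

Lemma frac_value_g0_d2 : frac_value phi (g0_d2 s a x0 x1 x2) (g0_d2 s' a' y0 y1 y2).
Proof.
have hd := frac_value_den; have hg := frac_value_g0; have hg1 := frac_value_g0_d1.
by rewrite /g0_d2 /conj_scale; frac_values; rewrite (natr_neq0_of_dvd nz).
Qed.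
End ComposedValues.

(** * The map on jets and its inverse *)

Section JetMap.
Variable F : fieldType.
Implicit Types (s a : F) (x : 'I_3 -> F).

Definition g0_jet_den s x : F := g0_den s (x (inord 0)) (x (inord 1)) (x (inord 2)).

Definition g0_jet_map s a x (i : 'I_3) : F :=
  match val i with
  | 0%N => g0 s a (x (inord 0)) (x (inord 1)) (x (inord 2))
  | 1%N => g0_d1 s a (x (inord 0)) (x (inord 1)) (x (inord 2))
  | _ => g0_d2 s a (x (inord 0)) (x (inord 1)) (x (inord 2))
  end.

Lemma ord3_ind (P : 'I_3 -> Prop) :
  P (inord 0) -> P (inord 1) -> P (inord 2) -> forall i, P i.
Proof.
move=> p0 p1 p2 i; have lt_i := ltn_ord i; rewrite -(inord_val i).
by move: (val i) lt_i => [|[|[|k]]].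
Qed.

Lemma g0_jet_den_conj s a x :
  g0_jet_den (- s) (g0_jet_map s a x) = conj_scale s * g0_jet_den s x.
Proof. by rewrite /g0_jet_den /g0_jet_map /= !inordK // g0_den_conj. Qed.

Lemma g0_jet_mapK s a x : s ^+ 2 = 3 -> 1056%:R != 0 :> F -> g0_jet_den s x != 0 ->
  g0_jet_map (- s) a (g0_jet_map s a x) =1 x.
Proof.
move=> s2 nz dn0; apply: ord3_ind; rewrite /g0_jet_map /= !inordK //=.
- exact: g0K.
- exact: g0_d1K.
- exact: g0_d2K.
Qed.
End JetMap.

Lemma frac_value_g0_jet_map (K : fieldType) n (E : fieldType)
    (phi : {rmorphism mpoly n K -> E}) s a (x : 'I_3 -> ratfun K n)
    s' a' (y : 'I_3 -> E) :
  1056%:R != 0 :> E -> g0_jet_den s' y != 0 ->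
  frac_value phi s s' -> frac_value phi a a' ->
  (forall i, frac_value phi (x i) (y i)) ->
  forall i, frac_value phi (g0_jet_map s a x i) (g0_jet_map s' a' y i).
Proof.
move=> nz dn0 hs ha hx; apply: ord3_ind; rewrite /g0_jet_map /= !inordK //=.
- exact: frac_value_g0.
- exact: frac_value_g0_d1.
- exact: frac_value_g0_d2.
Qed.

Section Substitution.
Variables (K : fieldType) (n : nat).

Let ratconst_zmod : zmod_morphism (@ratconst K n).
Proof. by move=> c d; rewrite /ratconst mpolyCB ratfunB. Qed.
Let ratconst_monoid : monoid_morphism (@ratconst K n).
Proof. by split=> [|c d]; rewrite /ratconst ?mpolyCM ?ratfunM // ?ratfun1. Qed.
HB.instance Definition _ := GRing.isZmodMorphism.Build K (ratfun K n)
  (@ratconst K n) ratconst_zmod.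
HB.instance Definition _ := GRing.isMonoidMorphism.Build K (ratfun K n)
  (@ratconst K n) ratconst_monoid.

Variable f : 'I_n -> ratfun K n.
HB.instance Definition _ := GRing.RMorphism.copy (subst_poly f) (mmap (@ratconst K n) f).

Lemma subst_const c : subst_poly f (mpolyC n c) = ratconst n c.
Proof. exact: mmapC. Qed.

Lemma subst_var i : subst_poly f (mpolyX K (mnm1 i)) = f i.
Proof. by rewrite /subst_poly mmapX mmap1U. Qed.
End Substitution.

Section Chazy.
Variables (K : numClosedFieldType) (a : K).
Local Notation RF := (ratfun K 3).
Local Notation s := (sqrtC 3 : K).
Local Notation S := (ratconst 3 s).
Local Notation A := (ratconst 3 a).
Local Notation X := (@ratvar K 3).

Let s2 : s ^+ 2 = 3. Proof. exact: sqrtCK. Qed.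

Lemma ratconst_sqr : S ^+ 2 = 3.
Proof. by rewrite -rmorphXn s2 rmorph_nat. Qed.

Lemma ratfun_1056_neq0 : 1056%:R != 0 :> RF.
Proof. by rewrite -(rmorph_nat (@ratconst K 3)) fmorph_eq0 numField_1056_neq0. Qed.

(** The denominator takes the value [- 1] at the point [(0, 0, 1)]. *)
Lemma g0_jet_den_var_neq0 (t : K) : g0_jet_den (ratconst 3 t) X != 0.
Proof.
pose e (i : 'I_3) : K := (i == inord 2)%:R.
have hx i : frac_value (meval e) (X i) (e i).
  by have := frac_value_poly (meval e) (mpolyX K (mnm1 i)); rewrite /= mevalXU.
have ht : frac_value (meval e) (ratconst 3 t) t.
  by have := frac_value_poly (meval e) (mpolyC 3 t); rewrite /= mevalC.
have := frac_value_den ht (hx (inord 0)) (hx (inord 1)) (hx (inord 2)).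
rewrite /e -!val_eqE /= !inordK //= => /frac_value_neq0; apply.
by rewrite /g0_den !mulr0 sub0r oppr_eq0 oner_neq0.
Qed.

(** Computing the iterated Lie derivatives of [g0_ratfun] makes [g0_map] the
    instance at the generic point of a map defined over every field. *)
Lemma g0_mapE i : g0_map a i = g0_jet_map S A X i.
Proof.
have LD := lieD (chazyXa_field a); have LM := lieM (chazyXa_field a).
have Ls := lie_const (chazyXa_field a) s; have La := lie_const (chazyXa_field a) a.
have Lx0 : lie_derivative (chazyXa_field a) (X (inord 0)) = X (inord 1).
  by rewrite lie_var /chazyXa_field /= inordK.
have Lx1 : lie_derivative (chazyXa_field a) (X (inord 1)) = X (inord 2).
  by rewrite lie_var /chazyXa_field /= inordK.
have Lx2 : lie_derivative (chazyXa_field a) (X (inord 2))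
    = chazyXa_rhs S A (X (inord 0)) (X (inord 1)).
  by rewrite lie_var /chazyXa_field /= inordK.
have dn0 := g0_jet_den_var_neq0 s.
have e1 := derivation_g0 LD LM ratconst_sqr ratfun_1056_neq0 Ls La Lx0 Lx1 Lx2 dn0.
have e2 := derivation_g0_d1 LD LM ratconst_sqr ratfun_1056_neq0 Ls La Lx0 Lx1 Lx2 dn0.
move: i; apply: ord3_ind; rewrite /g0_map /g0_jet_map /= !inordK //=.
by rewrite /g0_ratfun e1 e2.
Qed.

(** The inverse is the map of [- s], and [comp] covers both composites since
    conjugation exchanges their roles. *)
Lemma birational_g0_map : birational (g0_map a).
Proof.
have ms2 : (- s) ^+ 2 = 3 by rewrite sqrrN.
have hc (f : 'I_3 -> RF) c : frac_value (subst_poly f) (ratconst 3 c) (ratconst 3 c).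
  by rewrite -[X in frac_value _ _ X](subst_const f); exact: frac_value_poly.
have hv (f : 'I_3 -> RF) i : frac_value (subst_poly f) (X i) (f i).
  by rewrite -[X in frac_value _ _ X](subst_var f); exact: frac_value_poly.
have comp (t : K) (f g : 'I_3 -> RF) i : t ^+ 2 = 3 ->
    f =1 g0_jet_map (ratconst 3 t) A X -> g =1 g0_jet_map (ratconst 3 (- t)) A X ->
    composite_is f (g i) (X i).
  move=> t2 ef eg.
  have T2 : (ratconst 3 t) ^+ 2 = 3 by rewrite -rmorphXn t2 rmorph_nat.
  have dn0 := g0_jet_den_var_neq0 t.
  have fn0 : g0_jet_den (ratconst 3 (- t)) f != 0.
    rewrite (funext ef) rmorphN g0_jet_den_conj; apply: mulf_neq0 dn0.
    exact: conj_scale_neq0 T2 ratfun_1056_neq0.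
  have fK : g0_jet_map (ratconst 3 (- t)) A f i = X i.
    by rewrite (funext ef) rmorphN; apply: g0_jet_mapK T2 ratfun_1056_neq0 dn0 i.
  have := frac_value_g0_jet_map ratfun_1056_neq0 fn0 (hc f (- t)) (hc f a) (hv f) i.
  by rewrite -eg fK.
exists (g0_jet_map (ratconst 3 (- s)) A X); split=> i.
  exact: (comp s _ _ i s2 g0_mapE).
by apply: (comp (- s) _ _ i ms2) => // j; rewrite opprK g0_mapE.
Qed.

Lemma g0_map_has_value (u p : K -> K) t :
  g0_jet_den s (jet u t) != 0 -> (forall i, jet p t i = g0_jet_map s a (jet u t) i) ->
  forall i, has_value (g0_map a i) (jet u t) (jet p t i).
Proof.
move=> dn0 ep i; rewrite ep g0_mapE.
apply: (frac_value_g0_jet_map (phi := meval (jet u t))) => //.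
- exact: numField_1056_neq0.
- by rewrite -[X in frac_value _ _ X](mevalC (jet u t)); exact: frac_value_poly.
- by rewrite -[X in frac_value _ _ X](mevalC (jet u t)); exact: frac_value_poly.
- by move=> j; rewrite -[X in frac_value _ _ X](mevalXU (jet u t)); exact: frac_value_poly.
Qed.
End Chazy.

Unset Implicit Arguments.

Theorem theorem13p3 (R : realType) (alpha : Cplx R) :
  (forall (D : set (Cplx R)) (u : Cplx R -> Cplx R),
     solves (chazyXa_rhs (sqrtC 3) alpha) D u ->
     let u1 := u^`() in
     let u2 := u^`(2) in
     let p := fun t => g0 (sqrtC 3) alpha (u t) (u1 t) (u2 t) in
     let D' := [set t | D t /\ g0_den (sqrtC 3) (u t) (u1 t) (u2 t) != 0] in
     solves (chazyXb_rhs (sqrtC 3) alpha) D' p /\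
     (forall t, D' t ->
        forall i : 'I_3, has_value (g0_map alpha i) (jet u t) (jet p t i))) /\
  birational (g0_map alpha).
Proof.
split; last exact: birational_g0_map.
move=> D u sol u1 u2 p D'.
have s2 : (sqrtC 3 : Cplx R) ^+ 2 = 3 := sqrtCK _.
have [solp dp] := chazyXb_of_chazyXa s2 sol.
split=> [//|t Dt0].
have [Dt dn0] := Dt0; have [p1 p2] := dp t Dt0.
apply: g0_map_has_value; first by rewrite /g0_jet_den /jet !inordK.
by apply: ord3_ind; rewrite /g0_jet_map /jet /= !inordK //=.
Qed.
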